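(* Let $\sigma=\sum_{j=1}^m q_j\delta_{y_j}$ with $y_1<\dots<y_m$ be a probability measure on $\mathbb{R}$ with strictly positive masses $q_j>0$, $\sum_{j=1}^m q_j=1$, and cumulative levels $Q_j=\sum_{\ell=1}^j q_\ell$. Let $\mu=\sum_{i=1}^n p_i\delta_{x_i}$ with $x_1<\dots<x_n$ be a probability measure on $\mathbb{R}$ with strictly positive masses $p_i>0$, $\sum_{i=1}^n p_i=1$, and cumulative levels $P_i=\sum_{k=1}^i p_k$, $P_0=0$. Let $T_\mu=F_\mu^{-1}\circ F_\sigma$ be the discrete cumulative distribution transform of $\mu$ relative to $\sigma$, let $\widetilde\mu=(T_\mu)_\#\sigma$, and for each $i\in\{1,\dots,n\}$ let $$J_i=\{j\in\{1,\dots,m\}:\ P_{i-1}<Q_j\le P_i\}.$$ Then $\widetilde\mu=\mu$ if and only if $$\{P_1,\dots,P_n\}\subseteq\{Q_1,\dots,Q_m\}.$$ Equivalently (since $P_n=Q_m=1$), $\widetilde\mu=\mu$ if and only if $\{P_1,\dots,P_{n-1}\}\subseteq\{Q_1,\dots,Q_m\}$. In this case, $$p_i=\sum_{j\in J_i}q_j\qquad\text{for each } i=1,\dots,n.$$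
   Context: For a Borel probability measure $\mu$ on $\mathbb{R}$, $F_\mu(x)=\mu((-\infty,x])$ is its cumulative distribution function, and its generalized inverse is $F_\mu^{-1}(s)=\inf\{x\in\mathbb{R}: F_\mu(x)\ge s\}$ for $s\in(0,1]$. The discrete cumulative distribution transform (CDT) of $\mu$ relative to $\sigma$ is the map $T_\mu=F_\mu^{-1}\circ F_\sigma$, determined by its values on the support $\{y_1,\dots,y_m\}$ of $\sigma$, that is, $T_\mu(y_j)=F_\mu^{-1}(Q_j)$. The pushforward is $(T_\#\sigma)(A)=\sigma(T^{-1}(A))$ for Borel sets $A$. $\delta_x$ is the Dirac mass at $x$. *)

(* Defs.v *)
From mathcomp Require Import all_boot all_order all_algebra.
From mathcomp Require Import all_classical all_reals all_analysis.

Set Implicit Arguments.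
Unset Strict Implicit.
Unset Printing Implicit Defensive.

Import Order.TTheory GRing.Theory Num.Theory.
Import numFieldNormedType.Exports.

Local Open Scope classical_set_scope.
Local Open Scope ring_scope.

(* [fine] loses nothing: the values of a probability measure are finite. *)
Definition cdfR (R : realType) (mu : probability (measurableTypeR R) R)
    (x : R) : R :=
  fine (mu `]-oo, x]%classic).

(* Meaningful for [0 < s <= 1] only. Since [inf] is real-valued and total, it is
   a default value when the set is empty or has no lower bound; the latter
   happens for [s <= 0]. *)
Definition quantile (R : realType) (mu : probability (measurableTypeR R) R)
    (s : R) : R :=
  inf [set x : R | s <= cdfR mu x].

(* [quantile mu] is applied outside of (0, 1] exactly where [cdfR sigma]
   vanishes, which is a [sigma]-null set. *)
Definition cdt (R : realType) (sigma mu : probability (measurableTypeR R) R) :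
    measurableTypeR R -> measurableTypeR R :=
  quantile mu \o cdfR sigma.

(* Masses are indexed from 0 and levels from 1: [level p k] is the sum of the
   first [k] masses, hence [level p 0 = 0] and, for [i : 'I_n], the level that
   includes the mass [p i] is [level p i.+1]. *)
Definition level (R : realType) (n : nat) (p : 'I_n -> R) (k : nat) : R :=
  \sum_(l < n | (l < k)%N) p l.

Definition levels_in (R : realType) (n m : nat) (p : 'I_n -> R)
    (q : 'I_m -> R) (i : 'I_n) : {set 'I_m} :=
  [set j : 'I_m | level p i < level q j.+1 <= level p i.+1]%SET.

(* Main.v *)
(** The CDT sends [y j] to [x i] exactly when [j] lies in [levels_in p q i], so
    the push-forward puts the mass [\sum_(j in levels_in p q i) q j] on [x i].
    Testing the equality of the measures on the half-lines ]-oo, x i] says that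
    the sum of the [q j] whose cumulative level is at most [c = level p i.+1]
    equals [c]. Since these [j] form an initial segment, that sum is a level of
    [q], and it equals [c] if and only if [c] itself is a level of [q].
    Conversely, the difference of this identity at two consecutive [c] gives
    the mass [p i]. *)

Require Import Defs.
From mathcomp Require Import all_boot all_order all_algebra.
From mathcomp Require Import all_classical all_reals all_analysis.

Set Implicit Arguments.
Unset Strict Implicit.
Unset Printing Implicit Defensive.

Import Order.TTheory GRing.Theory Num.Theory.
Import numFieldNormedType.Exports.

Local Open Scope classical_set_scope.
Local Open Scope ring_scope.

(** * Cumulative levels and partial sums of masses *)

Lemma level0 (R : realType) (n : nat) (p : 'I_n -> R) : level p 0 = 0.
Proof. by rewrite /level big_pred0. Qed.

Lemma levelS (R : realType) (n : nat) (p : 'I_n -> R) (i : 'I_n) :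
  level p i.+1 = level p i + p i.
Proof.
rewrite /level (bigD1 i) //= addrC; congr (_ + _).
by apply: eq_bigl => l; rewrite ltnS ltn_neqAle andbC.
Qed.

Lemma level_full (R : realType) (n : nat) (p : 'I_n -> R) :
  level p n = \sum_(i < n) p i.
Proof. by apply: eq_bigl => i; rewrite ltn_ord. Qed.

Lemma level_lt (R : realType) (n : nat) (p : 'I_n -> R) (j k : nat) :
  (forall i, 0 < p i) -> (j < k <= n)%N -> level p j < level p k.
Proof.
move=> p_gt0; elim: k => [|k IHk] /andP[jk kn]; first by [].
rewrite (levelS p (Ordinal kn)) /=.
have : (j <= k)%N by [].
rewrite leq_eqVlt => /orP[/eqP->|{}jk]; first by rewrite ltrDl.
by rewrite (lt_trans (IHk _)) ?ltrDl// jk ltnW.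
Qed.

Lemma level_le (R : realType) (n : nat) (p : 'I_n -> R) (j k : nat) :
  (forall i, 0 < p i) -> (j <= n)%N -> (k <= n)%N ->
  (level p j <= level p k) = (j <= k)%N.
Proof.
move=> p_gt0 jn kn; have [jk|kj] := leqP j k; last first.
  by apply/negbTE; rewrite -ltNge level_lt // kj.
move: jk; rewrite leq_eqVlt => /orP[/eqP->|jk]; first exact: lexx.
by rewrite ltW // level_lt // jk.
Qed.

Lemma level_ge0 (R : realType) (n : nat) (p : 'I_n -> R) (k : nat) :
  (forall i, 0 < p i) -> 0 <= level p k.
Proof. by move=> p_gt0; apply: sumr_ge0 => i _; exact: ltW. Qed.

(** Take the predecessor of the least [k <= n] with [s <= level p k]; this [k] is not 0 because
    [level p 0 = 0 < s]. *)
Lemma level_bracket (R : realType) (n : nat) (p : 'I_n -> R) (s : R) :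
  0 < s <= level p n -> exists i : 'I_n, level p i < s <= level p i.+1.
Proof.
move=> /andP[s_gt0 s_le].
have exk : exists k, (s <= level p k) && (k <= n)%N.
  by exists n; rewrite s_le leqnn.
have [[|k] /andP[sk kn] kmin] := ex_minnP exk.
  by move: sk; rewrite level0 leNgt s_gt0.
exists (Ordinal kn); rewrite /= sk andbT ltNge; apply/negP => sk'.
by have := kmin k; rewrite sk' ltnW // ltnn => /(_ isT).
Qed.

Lemma sum_levels_le (R : realType) (m : nat) (q : 'I_m -> R) (c : R) :
  (forall j, 0 < q j) -> 0 <= c ->
  \sum_(j < m | level q j.+1 <= c) q j = c <->
  exists2 k, (k <= m)%N & c = level q k.
Proof.
move=> q_gt0 c_ge0; split=> [sumE|[k km ->]]; last first.
  by apply: eq_bigl => j; rewrite level_le.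
(* The witness is the largest [k <= m] with [level q k <= c]; index 0 qualifies since [0 <= c]. *)
have exk : exists k, (level q k <= c) && (k <= m)%N.
  by exists 0%N; rewrite level0 c_ge0.
have kub k : (level q k <= c) && (k <= m)%N -> (k <= m)%N by case/andP.
have [k /andP[kc km] kmax] := ex_maxnP exk kub.
exists k => //; rewrite -sumE; apply: eq_bigl => j; apply/idP/idP => [jc|jk].
  by apply: kmax; rewrite jc ltn_ord.
by rewrite (le_trans _ kc) // level_le.
Qed.

(** Cutting the indices up to [level p i.+1] at [level p i] expresses the mass of one block by sums
    of the kind treated in [sum_levels_le]. *)
Lemma sum_levels_in (R : realType) (n m : nat) (p : 'I_n -> R) (q : 'I_m -> R)
    (i : 'I_n) : (forall i, 0 < p i) ->
  \sum_(j in levels_in p q i) q j =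
  \sum_(j < m | level q j.+1 <= level p i.+1) q j -
  \sum_(j < m | level q j.+1 <= level p i) q j.
Proof.
move=> p_gt0; apply/eqP; rewrite eq_sym subr_eq; apply/eqP.
rewrite (bigID (fun j : 'I_m => level p i < level q j.+1)) /=.
congr (_ + _); apply: eq_bigl => j; first by rewrite inE andbC.
rewrite -leNgt andb_idl // => /le_trans; apply.
by rewrite level_le // ltnW.
Qed.

(** * Discrete measures: distribution functions, quantiles, push-forwards *)

Lemma le_of_lt_homo (R : realType) (n : nat) (x : 'I_n -> R) :
  (forall i k : 'I_n, (i < k)%N -> x i < x k) ->
  forall i k : 'I_n, (x i <= x k) = (i <= k)%N.
Proof.
move=> x_incr i k; have [|ki] := leqP i k; last first.
  by apply/negbTE; rewrite -ltNge x_incr.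
by rewrite leq_eqVlt => /orP[/eqP/val_inj->|/x_incr/ltW//]; rewrite lexx.
Qed.

Lemma discrete_measureE (R : realType) (n : nat) (x p : 'I_n -> R)
    (mu : probability (measurableTypeR R) R) :
  (forall A : set (measurableTypeR R), measurable A ->
     mu A = (\sum_(i < n) (p i)%:E * \d_(x i) A)%E) ->
  forall A : set (measurableTypeR R), measurable A ->
    mu A = (\sum_(i < n | x i \in A) p i)%:E.
Proof.
move=> muE A mA; rewrite muE // [in RHS]big_mkcond -sumEFin.
apply: eq_bigr => i _.
by rewrite diracE; case: (x i \in A); rewrite ?mule1 ?mule0.
Qed.

Lemma cdfR_discrete (R : realType) (n : nat) (x p : 'I_n -> R)
    (mu : probability (measurableTypeR R) R) :
  (forall A : set (measurableTypeR R), measurable A ->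
     mu A = (\sum_(i < n) (p i)%:E * \d_(x i) A)%E) ->
  forall t, cdfR mu t = \sum_(i < n | x i <= t) p i.
Proof.
move=> /discrete_measureE muE t; rewrite /cdfR muE; last exact: measurable_itv.
by apply: eq_bigl => i; apply/idP/idP; rewrite inE /= in_itv.
Qed.

Lemma cdfR_atom (R : realType) (n : nat) (x p : 'I_n -> R)
    (mu : probability (measurableTypeR R) R) :
  (forall A : set (measurableTypeR R), measurable A ->
     mu A = (\sum_(i < n) (p i)%:E * \d_(x i) A)%E) ->
  (forall i k : 'I_n, (i < k)%N -> x i < x k) ->
  forall i, cdfR mu (x i) = level p i.+1.
Proof.
move=> muE x_incr i; rewrite (cdfR_discrete muE); apply: eq_bigl => l.
by rewrite (le_of_lt_homo x_incr).
Qed.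

Lemma cdfR_le (R : realType) (mu : probability (measurableTypeR R) R) :
  {homo cdfR mu : s t / s <= t}.
Proof.
move=> s t st; rewrite /cdfR fine_le ?fin_num_measure //;
  do ?exact: measurable_itv.
apply: le_measure; rewrite ?inE; do ?exact: measurable_itv.
by apply: subset_itvl; rewrite bnd_simp.
Qed.

(** The set whose infimum is taken is the closed half-line from [x i]: [cdfR mu] reaches
    [level p i.+1 >= s] at [x i] and is at most [level p i < s] before it. *)
Lemma quantile_discrete (R : realType) (n : nat) (x p : 'I_n -> R)
    (mu : probability (measurableTypeR R) R) :
  (forall A : set (measurableTypeR R), measurable A ->
     mu A = (\sum_(i < n) (p i)%:E * \d_(x i) A)%E) ->
  (forall i k : 'I_n, (i < k)%N -> x i < x k) ->
  (forall i, 0 < p i) ->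
  forall (i : 'I_n) (s : R), level p i < s <= level p i.+1 ->
    quantile mu s = x i.
Proof.
move=> muE x_incr p_gt0 i s /andP[lt_s s_le].
rewrite /quantile; suff -> : [set t | s <= cdfR mu t] = `[x i, +oo[%classic.
  by rewrite inf_itv // bnd_simp.
apply/seteqP; split=> t /=; rewrite in_itv /= andbT; last first.
  by move=> /(cdfR_le mu); apply: le_trans; rewrite (cdfR_atom muE).
move=> s_cdf; rewrite leNgt; apply/negP => t_lt.
have := lt_le_trans lt_s s_cdf.
rewrite (cdfR_discrete muE) ltNge => /negP; apply.
(* Termwise comparison: [x l <= t < x i] forces [l < i], and the remaining terms on the left are
   0. *)
rewrite /level big_mkcond [leRHS]big_mkcond ler_sum // => l _.
case: ifPn => [xl|_]; last by case: ifP => // _; exact: ltW.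
by rewrite ltnNge -(le_of_lt_homo x_incr) -ltNge (le_lt_trans xl).
Qed.

(* [cdfR sigma] is Borel and has finite range, so that composing it with any
   function whatsoever, in particular with a quantile, is measurable. *)
Lemma measurable_preimage_cdt (R : realType) (m : nat) (y q : 'I_m -> R)
    (sigma mu : probability (measurableTypeR R) R) :
  (forall A : set (measurableTypeR R), measurable A ->
     sigma A = (\sum_(j < m) (q j)%:E * \d_(y j) A)%E) ->
  forall A : set R, measurable (cdt sigma mu @^-1` A).
Proof.
move=> sigmaE A.
(* Each value of [cdfR sigma] is some [w S], so the preimage is a finite union of level sets of
   [cdfR sigma]. *)
pose w (S : {set 'I_m}) := \sum_(j in S) q j.
have -> : cdt sigma mu @^-1` A =
    \bigcup_(S in [set S | A (quantile mu (w S))]) (cdfR sigma @^-1` [set w S]).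
  apply/seteqP; split=> [t At|t [S /= AS tS]]; last by rewrite /cdt /= tS.
  have tE : cdfR sigma t = w [set j | y j <= t]%SET.
    by rewrite (cdfR_discrete sigmaE); apply: eq_bigl => j; rewrite inE.
  by exists [set j | y j <= t]%SET; rewrite //= -tE.
apply: fin_bigcup_measurable; first exact: finite_finset.
move=> S _; rewrite -[X in measurable X]setTI.
exact: (measurable_realfun.nondecreasing_measurable measurableT
  (@cdfR_le _ sigma)).
Qed.

(** Only the atoms [y j] carry mass, and [cdfR sigma (y j)] is [level q j.+1]. *)
Lemma pushforward_cdtE (R : realType) (m : nat) (y q : 'I_m -> R)
    (sigma mu : probability (measurableTypeR R) R) :
  (forall A : set (measurableTypeR R), measurable A ->
     sigma A = (\sum_(j < m) (q j)%:E * \d_(y j) A)%E) ->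
  (forall j k : 'I_m, (j < k)%N -> y j < y k) ->
  forall A : set (measurableTypeR R),
    pushforward sigma (cdt sigma mu) A =
    (\sum_(j < m | quantile mu (level q j.+1) \in A) q j)%:E.
Proof.
move=> sigmaE y_incr A; rewrite /pushforward (discrete_measureE sigmaE).
  congr _%:E; apply: eq_bigl => j.
  by rewrite -(cdfR_atom sigmaE y_incr j); apply/idP/idP; rewrite !inE.
exact: (measurable_preimage_cdt _ sigmaE).
Qed.

(** * Comparison of the push-forward with [mu] *)

Theorem theorem4p2 (R : realType) (m n : nat)
    (y q : 'I_m -> R) (x p : 'I_n -> R)
    (sigma mu : probability (measurableTypeR R) R)
    (y_incr : forall j k : 'I_m, (j < k)%N -> y j < y k)
    (q_gt0 : forall j, 0 < q j)
    (q_sum1 : \sum_(j < m) q j = 1)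
    (sigmaE : forall A : set (measurableTypeR R), measurable A ->
      sigma A = (\sum_(j < m) (q j)%:E * \d_(y j) A)%E)
    (x_incr : forall i k : 'I_n, (i < k)%N -> x i < x k)
    (p_gt0 : forall i, 0 < p i)
    (p_sum1 : \sum_(i < n) p i = 1)
    (muE : forall A : set (measurableTypeR R), measurable A ->
      mu A = (\sum_(i < n) (p i)%:E * \d_(x i) A)%E) :
  let mu_tilde := pushforward sigma (cdt sigma mu) in
  let mu_tilde_eq_mu :=
    forall A : set (measurableTypeR R), measurable A -> mu_tilde A = mu A in
  [/\ mu_tilde_eq_mu <->
        [set level p k | k in [set k | (1 <= k <= n)%N]] `<=`
        [set level q k | k in [set k | (1 <= k <= m)%N]],
      mu_tilde_eq_mu <->
        [set level p k | k in [set k | (1 <= k <= n.-1)%N]] `<=`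
        [set level q k | k in [set k | (1 <= k <= m)%N]]
    & mu_tilde_eq_mu ->
        forall i : 'I_n, p i = \sum_(j in levels_in p q i) q j].
Proof.
move=> mu_tilde mu_tilde_eq_mu.
(* Both total masses are 1, so [level q j.+1] is positive and at most [level p n]. *)
have bracket (j : 'I_m) :
    exists i : 'I_n, level p i < level q j.+1 <= level p i.+1.
  apply: level_bracket; rewrite level_full p_sum1 -q_sum1 -level_full.
  rewrite level_le // ltn_ord andbT -[ltLHS](level0 q).
  by apply: level_lt => //=; exact: ltn_ord.
pose fixed c := \sum_(j < m | level q j.+1 <= c) q j = c.
(* The level of index 0, which [sum_levels_le] allows, is ruled out by [0 < level p k]. *)
have fixedP k : (1 <= k <= n)%N -> fixed (level p k) <->
    [set level q k | k in [set k | (1 <= k <= m)%N]] (level p k).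
  move=> /andP[k_gt0 kn]; rewrite /fixed sum_levels_le ?level_ge0 //.
  split=> [[l lm pq]|[l /= /andP[_ lm] <-]]; last by exists l.
  exists l => //=; rewrite lm andbT lt0n; apply/eqP => l0.
  have := @level_lt _ _ p 0 k p_gt0; rewrite k_gt0 kn pq l0 !level0 ltxx.
  by move/(_ isT).
have eq_fixed : mu_tilde_eq_mu -> forall i : 'I_n, fixed (level p i.+1).
  move=> eqmu i; pose A := `]-oo, x i]%classic.
  have mA : measurable (A : set (measurableTypeR R)) by exact: measurable_itv.
  have := eqmu _ mA; rewrite /mu_tilde (pushforward_cdtE _ sigmaE) //.
  rewrite (discrete_measureE muE) // => -[].
  rewrite [RHS](eq_bigl (fun l : 'I_n => (l < i.+1)%N)); last first.
    by move=> l; rewrite ltnS -(le_of_lt_homo x_incr);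
       apply/idP/idP; rewrite inE /A /= in_itv.
  rewrite -/(level p i.+1) => levelE; rewrite /fixed -[RHS]levelE.
  (* [y j] is sent to [x k], which lies in the half-line iff [k <= i], that is, iff
     [level q j.+1 <= level p i.+1]. *)
  apply: eq_bigl => j; have [k /andP[kj jk]] := bracket j.
  rewrite (quantile_discrete muE x_incr p_gt0 (i := k)) ?kj //.
  have -> : (x k \in A) = (x k <= x i).
    by apply/idP/idP; rewrite inE /A /= in_itv.
  rewrite (le_of_lt_homo x_incr); apply/idP/idP => [ji|ki]; last first.
    by rewrite (le_trans jk) // level_le.
  have := lt_le_trans kj ji.
  by rewrite ltNge level_le ?(ltnW (ltn_ord _)) // -ltnNge ltnS.
have fixed_mass : (forall i : 'I_n, fixed (level p i.+1)) ->
    forall i : 'I_n, p i = \sum_(j in levels_in p q i) q j.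
  move=> fixp i; rewrite sum_levels_in // fixp.
  suff -> : fixed (level p i) by rewrite levelS addrC addKr.
  (* For [i = 0] the lower level is 0, which is [level q 0]; otherwise it is the upper level of the
     preceding index. *)
  case: i => -[|i] lin /=; last exact: (fixp (Ordinal (ltnW lin))).
  by rewrite /fixed level0 sum_levels_le //; exists 0%N; rewrite ?level0.
have mass_eq : (forall i : 'I_n, p i = \sum_(j in levels_in p q i) q j) ->
    mu_tilde_eq_mu.
  move=> massE A mA; rewrite /mu_tilde (pushforward_cdtE _ sigmaE) //.
  rewrite (discrete_measureE muE) //; congr _%:E.
  (* [I j] is the index of the atom that receives [y j]; the mass is then grouped by the fibres of
     [I]. *)
  have [I jI] := choice bracket.
  have quantileE (j : 'I_m) : quantile mu (level q j.+1) = x (I j).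
    exact: (quantile_discrete muE x_incr p_gt0 (jI j)).
  rewrite (partition_big I (fun i => x i \in A)) /=; last first.
    by move=> j; rewrite quantileE.
  apply: eq_bigr => i xA; rewrite massE; apply: eq_bigl => j.
  rewrite quantileE inE; apply/andP/idP => [[_ /eqP <-]//|jJ].
  (* For [j] in the block of [i], the quantile is both [x (I j)] and [x i], and [x] is injective. *)
  suff Iji : I j = i by rewrite Iji eqxx.
  have := quantile_discrete muE x_incr p_gt0 jJ; rewrite quantileE => xE.
  by apply/val_inj/eqP; rewrite eqn_leq -!(le_of_lt_homo x_incr) xE lexx.
(* A general [k] serves both [k = n] and [k = n.-1]. *)
have fixed_sub k : (k <= n)%N ->
    (forall i : 'I_n, (i < k)%N -> fixed (level p i.+1)) <->
    [set level p k | k in [set l | (1 <= l <= k)%N]] `<=`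
    [set level q k | k in [set k | (1 <= k <= m)%N]].
  move=> kn; split=> [fixp _ [[//|l] /= lk <-]|sub i ik]; last first.
    by apply/(fixedP i.+1 (ltn_ord i))/sub; exists i.+1.
  have ln := leq_trans lk kn.
  by apply/(fixedP l.+1 ln); exact: (fixp (Ordinal ln)).
have eqP1 : mu_tilde_eq_mu <-> forall i : 'I_n, fixed (level p i.+1).
  by split=> [/eq_fixed//|/fixed_mass/mass_eq].
split; last by move=> /eq_fixed/fixed_mass.
  rewrite -fixed_sub // eqP1.
  by split=> fixp i *; apply: fixp.
rewrite -fixed_sub ?leq_pred // eqP1; split=> fixp i; first by [].
have [i_lt|i_ge] := ltnP i n.-1; first exact: fixp.
(* The last level of [p] is the total mass 1, which is [level q m], hence always fixed. *)
have -> : i.+1 = n.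
  by apply/eqP; rewrite eqn_leq ltn_ord -add1n -leq_subLR subn1.
rewrite level_full p_sum1 /fixed sum_levels_le //.
by exists m; rewrite // level_full q_sum1.
Qed.
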